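(* Let $R$ be a unital $*$-ring and let $a,b\in R$ be core invertible with $aba=ba^2=a^2b$. If $ab\,a^{(\#)}=a\,a^{(\#)}b$ and $ab\,b^{(\#)}=b\,b^{(\#)}a$, then $ab$ is core invertible and $(ab)^{(\#)}=a^{(\#)}b^{(\#)}$.
   Context: A unital $*$-ring is an associative ring $R$ with unity $1$ equipped with an involution $*:R\to R$ satisfying $(a+b)^*=a^*+b^*$, $(ab)^*=b^*a^*$ and $(a^* )^*=a$ for all $a,b\in R$. An element $a\in R$ is core invertible if there exists $x\in R$ with $axa=a$, $xax=x$, $(ax)^*=ax$, $xa^2=a$ and $ax^2=x$; such an $x$ is unique when it exists, is called the core inverse of $a$, and is denoted $a^{(\#)}$. *)

(* Defs.v *)
From HB Require Import structures.
From mathcomp Require Import all_boot all_algebra.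

Set Implicit Arguments.
Unset Strict Implicit.
Unset Printing Implicit Defensive.

Import GRing.Theory.
Local Open Scope ring_scope.

(* The base is pzRingType, so commutativity and 1 != 0 are not assumed. *)
HB.mixin Record PzRing_isStar R of GRing.PzRing R := {
  star : R -> R;
  starD : {morph star : x y / x + y};
  starM : forall x y, star (x * y) = star y * star x;
  starK : involutive star
}.

#[short(type="starRingType")]
HB.structure Definition StarRing := {R of PzRing_isStar R & GRing.PzRing R}.

Definition is_core_inverse (R : starRingType) (a x : R) : bool :=
  [&& a * x * a == a,
      x * a * x == x,
      star (a * x) == a * x,
      x * a ^+ 2 == a
    & a * x ^+ 2 == x].

Definition core_invertible (R : starRingType) (a : R) : Prop :=
  exists x, is_core_inverse a x.

(* By core_inverse_uniq below, the chosen x is the only core inverse of a. *)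
Definition core_inv (R : starRingType) (a : R) (ha : core_invertible a) : R :=
  xchoose ha.

Lemma core_invP (R : starRingType) (a : R) (ha : core_invertible a) :
  is_core_inverse a (core_inv ha).
Proof. exact: xchooseP. Qed.

Lemma core_inverse_uniq (R : starRingType) (a x y : R) :
  is_core_inverse a x -> is_core_inverse a y -> x = y.
Proof.
case/and5P=> /eqP axa /eqP xax /eqP sax /eqP xa2 /eqP ax2.
case/and5P=> /eqP aya /eqP yay /eqP say /eqP ya2 /eqP ay2.
have axy : a * x = a * y.
  have e1 : a * y * (a * x) = a * x by rewrite mulrA aya.
  have e2 : a * x * (a * y) = a * y by rewrite mulrA axa.
  by rewrite -sax -e1 starM sax say e2.
by rewrite -xax -mulrA axy -{1}ay2 !mulrA -(mulrA x a a) -expr2 xa2 -mulrA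
           -expr2 ay2.
Qed.

Lemma core_inv_eq (R : starRingType) (a x : R) (ha : core_invertible a) :
  is_core_inverse a x -> core_inv ha = x.
Proof. exact: core_inverse_uniq (core_invP ha). Qed.

(* Main.v *)
Require Import Defs.
From HB Require Import structures.
From mathcomp Require Import all_boot all_algebra.

Set Implicit Arguments.
Unset Strict Implicit.
Unset Printing Implicit Defensive.

Import GRing.Theory.
Local Open Scope ring_scope.

(** Write x and y for the core inverses of a and b. The products a x and b y
    are self-adjoint idempotents, and the hypotheses are disguised
    commutation relations.

    The commutator c = b a - a b satisfies a c = 0 = c a. As
    x = a x^2, this gives a b x = b a x, so the hypothesis on a b x says that
    b commutes with a x; hence a x c = c, so that c lies in
    a R, where left multiplication by a is injective because x a^2 = a. Thus
    c = 0 and a b = b a ([comm_of_core_hyp]). The hypothesis on a b y then says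
    that a commutes with b y.

    An element commuting with a and with a x commutes with x
    ([comm_core_inverse]). This gives b x = x b and a y = y a. The two
    projections commute, by taking adjoints in (a x)(b y)(a x) = (b y)(a x)
    ([comm_projections]). Applying [comm_core_inverse] twice more yields
    x y = y x. Once all four elements commute across the two pairs, the axioms
    of a core inverse hold for a b and x y factor by factor
    ([is_core_inverseM]). *)

Section CoreInverse.
Variable R : starRingType.
Implicit Types a b c x y : R.

(** Since x = a x^2, the relation with a moves c past the leading factor, and
    x a^2 = a absorbs the surplus factors: both c x and x c equal x a c x. *)
Lemma comm_core_inverse a x c : is_core_inverse a x ->
  GRing.comm c a -> GRing.comm c (a * x) -> GRing.comm c x.
Proof.
case/and5P=> _ /eqP xax _ /eqP xa2 /eqP ax2 ca cax.
have cxE : c * x = x * a * c * x.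
  have cx : c * x = a * (c * x ^+ 2) by rewrite -{1}ax2 !mulrA ca.
  by rewrite -[in RHS]mulrA cx -{1}xa2 expr2 !mulrA.
have xcE : x * c = x * a * c * x.
  by rewrite -{1}xax -!mulrA (mulrA a x c) -cax (mulrA c a x) ca !mulrA.
by rewrite /GRing.comm cxE -xcE.
Qed.

(** Substituting x = a x^2 turns a b x into b a x, so b commutes with a x. The
    relations on a b a identify a b with b a after left multiplication by a,
    which x cancels once both products are known to lie in a R. *)
Lemma comm_of_core_hyp a b x : is_core_inverse a x ->
  a * b * a = b * a ^+ 2 -> b * a ^+ 2 = a ^+ 2 * b ->
  a * b * x = a * x * b -> GRing.comm a b /\ GRing.comm b (a * x).
Proof.
case/and5P=> /eqP axa _ _ /eqP xa2 /eqP ax2 aba ba2 abx.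
have bp : b * (a * x) = a * x * b.
  have -> : b * (a * x) = b * a ^+ 2 * x ^+ 2 by rewrite (expr2 a) -!mulrA ax2.
  by rewrite -aba -(mulrA (a * b)) ax2.
split=> //; rewrite /GRing.comm.
have baE : b * a = a * (x * b * a).
  by rewrite -{1}axa !mulrA -(mulrA b) bp.
(* By bp, b a = (a x) (b a) lies in a R, on which left multiplication by x a is
   the identity. *)
have -> : b * a = x * a * (b * a).
  by rewrite baE !mulrA -(mulrA x a a) -expr2 xa2.
by rewrite -mulrA (mulrA a b) aba ba2 mulrA xa2.
Qed.

(** With p = a x, commutation of a with q gives p q p = q p, because a x a = a;
    the left-hand side is self-adjoint, hence so is q p. *)
Lemma comm_projections a x q : is_core_inverse a x -> star q = q ->
  GRing.comm a q -> GRing.comm (a * x) q.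
Proof.
case/and5P=> /eqP axa _ /eqP sp _ _ sq aq.
have qpE : a * x * q * (a * x) = q * (a * x).
  by rewrite -(mulrA _ q) (mulrA q a x) -aq !mulrA axa.
move: (a * x) sp qpE => p sp qpE; move/(congr1 star): (qpE).
by rewrite !starM sp sq mulrA qpE.
Qed.

(** Commutation across the pairs (a, x) and (b, y) separates each product into a
    word in a, x times a word in b, y, where the axioms for a and for b apply.
    Self-adjointness of (a x)(b y) follows because these projections commute. *)
Lemma is_core_inverseM a b x y :
  is_core_inverse a x -> is_core_inverse b y ->
  GRing.comm a b -> GRing.comm a y -> GRing.comm b x -> GRing.comm x y ->
  is_core_inverse (a * b) (x * y).
Proof.
case/and5P=> /eqP axa /eqP xax /eqP sax /eqP xa2 /eqP ax2.
case/and5P=> /eqP byb /eqP yby /eqP sby /eqP yb2 /eqP by2 ab ay bx xy.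
have mulACA u v w z : GRing.comm v w -> u * v * (w * z) = u * w * (v * z).
  by move=> vw; rewrite !mulrA -(mulrA u v) vw !mulrA.
have pE : a * b * (x * y) = a * x * (b * y) by exact: mulACA.
have qE : x * y * (a * b) = x * a * (y * b) by apply: mulACA.
have bax : GRing.comm b (a * x) by apply: commrM.
have yax : GRing.comm y (a * x) by apply: commrM.
have pq : GRing.comm (b * y) (a * x).
  by apply/commr_sym/commrM; apply: commr_sym.
have bya : GRing.comm (b * y) a by apply/commr_sym/commrM.
apply/and5P; split; apply/eqP.
- by rewrite pE mulACA // axa byb.
- rewrite qE mulACA ?xax ?yby //.
  by apply/commr_sym/commrM => //; apply: commr_sym.
- by rewrite pE starM sax sby pq.
- rewrite exprMn_comm // mulACA ?xa2 ?yb2 //.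
  by apply/commrX/commr_sym.
- by rewrite exprMn_comm // mulACA ?ax2 ?by2 //; apply: commrX.
Qed.

End CoreInverse.

Theorem theorem3p2 (R : starRingType) (a b : R)
    (ha : core_invertible a) (hb : core_invertible b)
    (haba : a * b * a = b * a ^+ 2) (hba2 : b * a ^+ 2 = a ^+ 2 * b)
    (habac : a * b * core_inv ha = a * core_inv ha * b)
    (habbc : a * b * core_inv hb = b * core_inv hb * a) :
  exists hab : core_invertible (a * b),
    core_inv hab = core_inv ha * core_inv hb.
Proof.
have hx := core_invP ha; have hy := core_invP hb.
move: (core_inv ha) (core_inv hb) hx hy habac habbc => x y hx hy abx aby.
have [ab bp] := comm_of_core_hyp hx haba hba2 abx.
have aq : GRing.comm a (b * y) by rewrite /GRing.comm mulrA.
have bx := comm_core_inverse hx (commr_sym ab) bp.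
have ay := comm_core_inverse hy ab aq.
have sq : star (b * y) = b * y by case/and5P: hy => _ _ /eqP.
have pq := comm_projections hx sq aq.
have py := comm_core_inverse hy (commr_sym bp) pq.
have yx := comm_core_inverse hx (commr_sym ay) (commr_sym py).
have hxy := is_core_inverseM hx hy ab ay bx (commr_sym yx).
have hab : core_invertible (a * b) by exists (x * y).
by exists hab; apply: core_inv_eq.
Qed.
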